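(* Consider the uncertain plant, the partition $K=K_1\cup\dots\cup K_N$, the set-valued observers $X_1,\dots,X_N$, the controllers $C_1,\dots,C_N$ and the switching algorithm described in the context, and let $\gamma>0$. Let $\xi(k)=[d(k),\,n(k)]$ be the performance input and $z(k)=y(k)$ the performance output. Suppose that: (1) for each $i$ and each $k\ge 1$ the solution of the $i$-th set-valued observer is $X_i(k)=\bar X_i(k)\cap\tilde X(y(k))$ (the observers are non-conservative); (2) for every sampling time $k$ the true state satisfies $x(k)\in X_i(k)$ for some $i\in\{1,\dots,N\}$; (3) the closed-loop system with any of the $N$ controllers does not have a finite escape time; (4) whenever $k_1\in K_i$, the controller $C_i$ stabilizes the plant and guarantees a closed-loop $\mathcal{L}_2$-induced norm from the performance inputs $\xi$ to the performance outputs $z$ smaller than $\gamma$; (5) whenever $k_1\in K_i$: for all $d,n$ with $|d|\le1$, $|n|\le1$ and all $x(0)\in X(0)$ there exist a set $U^*$ of input sequences and a time $t_2$ such that $X_j(t)=\emptyset$ for all $t\ge t_2$, all $j\ne i$, and all input sequences $u^*\in U^*$. Suppose further that the control input applied to the plant satisfies $u\in U^*$. Then, for some large enough time instant $t_1$, the $\mathcal{L}_2$-induced norm from the performance inputs to the performance outputs, for $k\ge t_1$, is smaller than $\gamma$.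
   Context: Notation: for a vector $v$, $|v|=\max_i|v_i|$. Plant. The discrete-time plant is $$x(k+1)=A x(k)+A_1\Delta_1(k)x(k)+L_d d(k)+B u(k),\qquad y(k)=Cx(k)+n(k),$$ with real constant matrices $A,A_1,L_d,B,C$, scalar parametric uncertainty $|\Delta_1(k)|\le 1$, disturbance $|d(k)|\le 1$, sensor noise $|n(k)|\le 1$, control input $u(k)$, measured output $y(k)$, state $x(k)\in\mathbb{R}^n$, and $x(0)\in X(0):=\{q: M_0q\le m_0\}$ for a given matrix $M_0$ and vector $m_0$. The uncertainty is the value of one scalar parameter $k_1\in K\subseteq\mathbb{R}$: each value $\kappa\in K$ of $k_1$ corresponds to a value $\delta(\kappa)\in[-1,1]$ of $\Delta_1$, and we write $A(\kappa):=A+\delta(\kappa)A_1$. A plant of this model ''with $k_1\in K_i$'' is one in which the value of the parameter lies in $K_i$ at all times. The set $K$ is partitioned as $K=K_1\cup\dots\cup K_N$, and for each $K_i$ a controller $C_i$ (mapping measured outputs to control inputs) is given. Set-valued observers. The observer #$i$ is designed for $k_1\in K_i$ and produces sets $X_i(k)$, with $X_i(0)=X(0)$. Define $$\tilde X(y(k))=\{x: y(k)=Cx+n \text{ for some } |n|\le 1\},$$ $$\bar X_i(k)=\{x: x=A(\kappa)w+Bu(k-1)+L_d d \text{ for some } \kappa\in K_i,\ w\in X_i(k-1),\ |d|\le 1\}.$$ Observer #$i$ is said to fail at time $k$ if $X_i(k)=\emptyset$. Switching algorithm. At each time one controller is connected to the plant. Initially the selected index is $i=1$. As long as $X_i(k)\neq\emptyset$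 for the currently selected index $i$, controller $C_i$ is kept. If $X_i(k)=\emptyset$, index $i$ is discarded permanently and the algorithm moves to $i+1$ (repeating if the set of the new index is also empty), so $C_{i+1}$ becomes the selected controller. Stability and performance. ''$C_i$ stabilizes the plant'' means that the feedback interconnection has bounded output $y$ for all $|d(k)|\le1$, $|n(k)|\le1$, whatever the time and the (finite) plant and controller states at which $C_i$ is connected. ''No finite escape time'' means all signals remain finite at every finite time. The $\mathcal{L}_2$-induced norm of a closed loop is the usual one: the supremum of $\|z\|_2/\|\xi\|_2$ over nonzero square-summable $\xi$, with zero initial conditions. The induced norm ''for $k\ge t_1$'' is that of the closed loop which is in operation on $k\ge t_1$, i.e. the plant in feedback with the controller selected by the algorithm on $k\ge t_1$. *)

(* Defs.v *)
From HB Require Import structures.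
From mathcomp Require Import all_boot all_order all_algebra.
From mathcomp Require Import all_classical all_reals all_analysis.

Set Implicit Arguments.
Unset Strict Implicit.
Unset Printing Implicit Defensive.

Import Order.TTheory GRing.Theory Num.Theory.
Import numFieldNormedType.Exports.
Local Open Scope classical_set_scope.
Local Open Scope ring_scope.

(* Conventions.
   - Signals are functions of the time [k : nat]; the library norm `|v| of a
     matrix is its max norm.
   - In a feedback interconnection a sample has type [option 'cV[R]_m], where
     [None] is a sample that is not finite; a finite escape time is a time
     from which samples are [None].
   - The indices 1, ..., N are the elements 0, ..., N - 1 of ['I_N]. *)

Definition unit_bounded (R : realType) (m : nat) (w : nat -> 'cV[R]_m) : Prop :=
  forall k, `|w k| <= 1.

Definition polytope (R : realType) (r m : nat) (M : 'M[R]_(r, m))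
    (b : 'cV[R]_r) : set 'cV[R]_m :=
  [set q | forall i, (M *m q) i 0 <= b i 0].

Record plant (R : realType) (nx nd nu ny : nat) := Plant {
  plA : 'M[R]_nx;
  plA1 : 'M[R]_nx;
  plLd : 'M[R]_(nx, nd);
  plB : 'M[R]_(nx, nu);
  plC : 'M[R]_(ny, nx);
  (* the value of the uncertainty when the scalar parameter has a given value *)
  pldelta : R -> R }.

(* A controller maps measured outputs to control inputs through a state, which
   ranges over a real vector space of any dimension. *)
Record controller (R : realType) (nu ny : nat) := Controller {
  cstate : lmodType R;
  cupd : cstate -> 'cV[R]_ny -> option cstate;
  cout : cstate -> 'cV[R]_ny -> option 'cV[R]_nu }.

Section ClosedLoop.
Variables (R : realType) (nx nd nu ny : nat) (P : plant R nx nd nu ny).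

Definition A_of (kappa : R) : 'M[R]_nx := plA P + pldelta P kappa *: plA1 P.

Definition plant_next (kappa : R) (x : 'cV[R]_nx) (u : 'cV[R]_nu)
    (d : 'cV[R]_nd) : 'cV[R]_nx :=
  A_of kappa *m x + plLd P *m d + plB P *m u.

Definition plant_out (x : 'cV[R]_nx) (n : 'cV[R]_ny) : 'cV[R]_ny :=
  plC P *m x + n.

(* The parameter may vary with time, but it stays in the cell. *)
Definition parameter_in (Ki : set R) (k1 : nat -> R) : Prop :=
  forall k, Ki (k1 k).

(* Response of the plant alone to a given input sequence. *)
Fixpoint plant_state (k1 : nat -> R) (d : nat -> 'cV[R]_nd) (x0 : 'cV[R]_nx)
    (u : nat -> 'cV[R]_nu) (k : nat) : 'cV[R]_nx :=
  if k is k'.+1 then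
    plant_next (k1 k') (plant_state k1 d x0 u k') (u k') (d k')
  else x0.

Definition plant_output (k1 : nat -> R) (d : nat -> 'cV[R]_nd)
    (n : nat -> 'cV[R]_ny) (x0 : 'cV[R]_nx) (u : nat -> 'cV[R]_nu)
    (k : nat) : 'cV[R]_ny :=
  plant_out (plant_state k1 d x0 u k) (n k).

(* The plant in feedback with the single controller [c], connected at time [t0]
   with plant state [x0] and controller state [q0]; samples of the loop, of [d]
   and of [n] are numbered from the time of connection. *)
Fixpoint loop (c : controller R nu ny) (k1 : nat -> R) (t0 : nat)
    (d : nat -> 'cV[R]_nd) (n : nat -> 'cV[R]_ny) (x0 : 'cV[R]_nx)
    (q0 : cstate c) (k : nat) : option ('cV[R]_nx * cstate c) :=
  if k is k'.+1 then
    if loop k1 t0 d n x0 q0 k' is Some (x, q) then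
      let y := plant_out x (n k') in
      match cupd q y, cout q y with
      | Some q', Some u => Some (plant_next (k1 (t0 + k')%N) x u (d k'), q')
      | _, _ => None
      end
    else None
  else Some (x0, q0).

Definition loop_output (c : controller R nu ny) (k1 : nat -> R) (t0 : nat)
    (d : nat -> 'cV[R]_nd) (n : nat -> 'cV[R]_ny) (x0 : 'cV[R]_nx)
    (q0 : cstate c) (k : nat) : option 'cV[R]_ny :=
  omap (fun s => plant_out s.1 (n k)) (loop k1 t0 d n x0 q0 k).

(* The state at time k + 1 is finite only if the output, the control input and
   the controller state involved at time k are. *)
Definition no_finite_escape (c : controller R nu ny) (k1 : nat -> R) : Prop :=
  forall (t0 : nat) (d : nat -> 'cV[R]_nd) (n : nat -> 'cV[R]_ny)
    (x0 : 'cV[R]_nx) (q0 : cstate c),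
    unit_bounded d -> unit_bounded n ->
    forall k, loop k1 t0 d n x0 q0 k <> None.

Definition stabilizes (c : controller R nu ny) (k1 : nat -> R) : Prop :=
  forall (t0 : nat) (d : nat -> 'cV[R]_nd) (n : nat -> 'cV[R]_ny)
    (x0 : 'cV[R]_nx) (q0 : cstate c),
    unit_bounded d -> unit_bounded n ->
    exists M : R, forall k,
      exists2 y, loop_output k1 t0 d n x0 q0 k = Some y & `|y| <= M.

(* Squared Euclidean norm of a sample; +oo if the sample is not finite. *)
Definition energy (m : nat) (w : option 'cV[R]_m) : \bar R :=
  if w is Some v then (\sum_(i < m) v i 0 ^+ 2)%:E else +oo%E.

Definition l2norm (m : nat) (w : nat -> option 'cV[R]_m) : \bar R :=
  sqrte (\sum_(0 <= k <oo) energy (w k))%E.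

(* L2-induced norm, from xi = [d, n] to z = y, of the loop in operation on
   k >= t0, with zero plant and controller states at time t0. *)
Definition l2_induced_norm (c : controller R nu ny) (k1 : nat -> R)
    (t0 : nat) : \bar R :=
  ereal_sup [set g | exists xi : nat -> 'cV[R]_(nd + ny),
    let nxi := l2norm (fun k => Some (xi k)) in
    let z := loop_output (c := c) k1 t0 (fun k => usubmx (xi k))
               (fun k => dsubmx (xi k)) 0 0 in
    [/\ exists k, xi k != 0, (nxi < +oo)%E & g = (l2norm z / nxi)%E]].

End ClosedLoop.

(* A set-valued observer: the set it produces at each time from the records of
   the control input and of the measured output. *)
Definition observer (R : realType) (nx nu ny : nat) :=
  (nat -> 'cV[R]_nu) -> (nat -> 'cV[R]_ny) -> nat -> set 'cV[R]_nx.

Section Observers.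
Variables (R : realType) (nx nd nu ny : nat) (P : plant R nx nd nu ny).

Definition Xtilde (y : 'cV[R]_ny) : set 'cV[R]_nx :=
  [set x | exists2 n : 'cV[R]_ny, `|n| <= 1 & y = plC P *m x + n].

(* [X] is the set at the previous time and [u] the previous input. *)
Definition Xbar (Ki : set R) (X : set 'cV[R]_nx) (u : 'cV[R]_nu) :
    set 'cV[R]_nx :=
  [set x | exists (kappa : R) (w : 'cV[R]_nx) (d : 'cV[R]_nd),
    [/\ Ki kappa, X w, `|d| <= 1 &
        x = A_of P kappa *m w + plB P *m u + plLd P *m d]].

Definition nonconservative (Ki : set R) (X : observer R nx nu ny) : Prop :=
  forall (u : nat -> 'cV[R]_nu) (y : nat -> 'cV[R]_ny) (k : nat), (1 <= k)%N ->
    X u y k = Xbar Ki (X u y k.-1) (u k.-1) `&` Xtilde (y k).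

End Observers.

(* The first index, from [m] on, whose set is not empty; [None] if all the
   remaining indices are to be discarded. *)
Definition next_index (T : Type) (N : nat) (X : 'I_N -> set T) (m : nat) :
    option 'I_N :=
  ohead [seq j : 'I_N <- enum 'I_N | (m <= j)%N && `[< X j !=set0 >]].

Fixpoint selected (T : Type) (N : nat) (X : 'I_N -> nat -> set T) (k : nat) :
    option 'I_N :=
  if k is k'.+1 then
    if selected X k' is Some i then next_index (fun j => X j k) i else None
  else next_index (fun j => X j 0%N) 0.

(* Record of a signal; the value at non-finite samples is immaterial. *)
Definition recorded (R : realType) (m : nat) (w : nat -> option 'cV[R]_m)
    (k : nat) : 'cV[R]_m := odflt 0 (w k).

Section SwitchedLoop.
Variables (R : realType) (nx nd nu ny N : nat) (P : plant R nx nd nu ny).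
Variables (C : 'I_N -> controller R nu ny) (X : 'I_N -> observer R nx nu ny).

Definition switch_index (u : nat -> option 'cV[R]_nu)
    (y : nat -> option 'cV[R]_ny) : nat -> option 'I_N :=
  selected (fun j => X j (recorded u) (recorded y)).

(* [x], [u], [y] are the signals of the plant under the switching algorithm and
   [q k i] is the state of controller i, which matters only while i is the
   selected index.  A controller is connected with an arbitrary finite state. *)
Definition switched_loop (k1 : nat -> R) (d : nat -> 'cV[R]_nd)
    (n : nat -> 'cV[R]_ny) (x0 : 'cV[R]_nx) (x : nat -> option 'cV[R]_nx)
    (u : nat -> option 'cV[R]_nu) (y : nat -> option 'cV[R]_ny)
    (q : nat -> forall i : 'I_N, option (cstate (C i))) : Prop :=
  let sigma := switch_index u y in
  [/\ x 0%N = Some x0,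
      forall k, x k.+1 =
        obind (fun v => omap (fun w => plant_next P (k1 k) v w (d k)) (u k))
          (x k),
      forall k, y k = omap (fun v => plant_out P v (n k)) (x k),
      forall k, u k =
        (if sigma k is Some i then
           obind (fun s => obind (fun v => cout s v) (y k)) (q k i)
         else None) &
      (forall i, sigma 0%N = Some i -> exists s, q 0%N i = Some s) /\
      (forall k i, sigma k.+1 = Some i ->
         if sigma k == Some i then
           q k.+1 i = obind (fun s => obind (fun v => cupd s v) (y k)) (q k i)
         else exists s, q k.+1 i = Some s)].

End SwitchedLoop.

(* Main.v *)
(* The cell containing the parameter is never discarded: by non-conservativeness
   the true state always belongs to its observer's set.  Hence the selected index
   is always defined and, between switches, the loop is that of a single
   controller, which has no finite escape.  Being finite, the record of the input
   reproduces the measured output, so the other observers eventually fail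
   and the correct controller is selected from then on.  Its induced norm from
   that time is the induced norm from time 0 for the shifted parameter. *)
Require Import Defs.
From mathcomp Require Import all_boot all_order all_algebra.
From mathcomp Require Import all_classical all_reals all_analysis.

Set Implicit Arguments.
Unset Strict Implicit.

Import Order.TTheory GRing.Theory Num.Theory.
Import numFieldNormedType.Exports.
Local Open Scope classical_set_scope.
Local Open Scope ring_scope.

(** The enumeration of ['I_N] is strictly increasing and filtering keeps it so; the head of the
    filtered list is therefore its least element, and [i] is in that list. *)
Lemma next_index_le (T : Type) (N : nat) (X : 'I_N -> set T) (m : nat)
    (i : 'I_N) :
  (m <= i)%N -> X i !=set0 ->
  exists j : 'I_N, [/\ next_index X m = Some j, (j <= i)%N & X j !=set0].
Proof.
move=> mi Xi; rewrite /next_index.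
set p := fun j : 'I_N => (m <= j)%N && `[< X j !=set0 >].
have : sorted (relpre val ltn) [seq j <- enum 'I_N | p j].
  apply: sorted_filter; first by move=> a b c; apply: ltn_trans.
  by rewrite -sorted_map val_enum_ord; apply: iota_ltn_sorted.
have : i \in [seq j <- enum 'I_N | p j].
  by rewrite mem_filter mem_enum andbT /p mi; apply/asboolP.
have : all p [seq j <- enum 'I_N | p j] by apply: filter_all.
case: [seq j <- enum 'I_N | p j] => [//|j s] /= /andP[/andP[_ /asboolP Xj] _].
move=> + hs; rewrite inE => /predU1P[<-|js]; first by exists i.
exists j; split=> //; apply: ltnW.
have /allP := order_path_min (fun a b c => @ltn_trans _ _ _) hs.
by apply.
Qed.

(** Each search resumes from the current index, which is still at most [i], so it cannot jump over
    [i] while the set of [i] has never been empty. *)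
Lemma selected_le (T : Type) (N : nat) (X : 'I_N -> nat -> set T) (i : 'I_N)
    (k : nat) :
  (forall l, (l <= k)%N -> X i l !=set0) ->
  exists j : 'I_N, [/\ selected X k = Some j, (j <= i)%N & X j k !=set0].
Proof.
elim: k => [|k IHk] Xi /=; first by apply: next_index_le => //; apply: Xi.
have [j [-> ji _]] := IHk (fun l lk => Xi l (leqW lk)).
by apply: (@next_index_le _ _ (fun j => X j k.+1)) => //; apply: Xi.
Qed.

Section Plant.
Variables (R : realType) (nx nd nu ny : nat) (P : plant R nx nd nu ny).

Lemma loop_shift (c : controller R nu ny) k1 t0 d n x0 (q0 : cstate c) k :
  loop P k1 t0 d n x0 q0 k = loop P (fun l => k1 (t0 + l)%N) 0 d n x0 q0 k.
Proof. by elim: k => //= k ->. Qed.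

(** Samples of [d] and [n] are numbered from the connection, so [t0] enters the loop only through
    the parameter sequence. *)
Lemma l2_induced_norm_shift (c : controller R nu ny) k1 t0 :
  l2_induced_norm P c k1 t0 = l2_induced_norm P c (fun l => k1 (t0 + l)%N) 0.
Proof.
have E d n x0 (q0 : cstate c) : loop_output P k1 t0 d n x0 q0 =
    loop_output P (fun l => k1 (t0 + l)%N) 0 d n x0 q0.
  by apply/funext => k; rewrite /loop_output loop_shift.
rewrite /l2_induced_norm; congr ereal_sup.
by apply/seteqP; split=> g [xi hxi]; exists xi; move: hxi; rewrite /= E.
Qed.

Lemma loop_next (c : controller R nu ny) k1 t0 d n x0 (q0 : cstate c) k v s :
  loop P k1 t0 d n x0 q0 k = Some (v, s) ->
  loop P k1 t0 d n x0 q0 k.+1 <> None ->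
  exists w s', [/\ cout s (plant_out P v (n k)) = Some w,
    cupd s (plant_out P v (n k)) = Some s' &
    loop P k1 t0 d n x0 q0 k.+1 =
      Some (plant_next P (k1 (t0 + k)%N) v w (d k), s')].
Proof.
move=> /= ->.
case: (cupd s _) => [s'|//]; case: (cout s _) => [w|//] _.
by exists w, s'.
Qed.

Lemma nonconservative_next (Ki : set R) (X : observer R nx nu ny) u y k kappa
    v d n :
  nonconservative P Ki X -> Ki kappa -> `|d| <= 1 -> `|n| <= 1 ->
  X u y k v -> y k.+1 = plant_out P (plant_next P kappa v (u k) d) n ->
  X u y k.+1 (plant_next P kappa v (u k) d).
Proof.
move=> hX Kk hd hn Xv hy; rewrite hX //; split; last by exists n.
by exists kappa, v, d; split=> //=; rewrite /plant_next addrAC.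
Qed.

Variables (N : nat) (C : 'I_N -> controller R nu ny).
Variables (X : 'I_N -> observer R nx nu ny).
Variables (k1 : nat -> R) (d : nat -> 'cV[R]_nd) (n : nat -> 'cV[R]_ny).
Variables (x0 : 'cV[R]_nx) (x : nat -> option 'cV[R]_nx).
Variables (u : nat -> option 'cV[R]_nu) (y : nat -> option 'cV[R]_ny).
Variables (q : nat -> forall i : 'I_N, option (cstate (C i))).
Hypotheses (hd : unit_bounded d) (hn : unit_bounded n).
Hypothesis hrun : switched_loop P X k1 d n x0 x u y q.
Hypothesis hesc : forall i, no_finite_escape P (C i) k1.

Let sigma := switch_index X u y.

(** The last clause places the current state on a trajectory of controller [i] alone, connected at
    some time [t0]; this is the form to which [no_finite_escape] applies. *)
Let connected (k : nat) (i : 'I_N) (v : 'cV[R]_nx) (s : cstate (C i)) : Prop :=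
  [/\ x k = Some v, sigma k = Some i, q k i = Some s &
    exists t0 m xs (qs : cstate (C i)), k = (t0 + m)%N /\
      loop P k1 t0 (fun l => d (t0 + l)%N) (fun l => n (t0 + l)%N) xs qs m
        = Some (v, s)].

Let connected_next k i v (s : cstate (C i)) :
  connected k v s ->
  exists w, [/\ u k = Some w, x k.+1 = Some (plant_next P (k1 k) v w (d k)) &
    forall j, sigma k.+1 = Some j -> exists s' : cstate (C j),
      connected k.+1 (plant_next P (k1 k) v w (d k)) s'].
Proof.
have [_ hx hy hu [_ hq]] := hrun.
move=> [xk sk qk [t0 [m [xs [qs [kE Lm]]]]]].
have [w [s' [ow us Lm1]]] :=
  loop_next Lm
    (@hesc i t0 _ _ xs qs (fun l => hd (t0 + l)%N) (fun l => hn (t0 + l)%N)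
      m.+1).
rewrite -kE in ow us Lm1.
have yk : y k = Some (plant_out P v (n k)) by rewrite hy xk.
have uk : u k = Some w by rewrite hu -/sigma sk qk /= yk /= ow.
have xk1 : x k.+1 = Some (plant_next P (k1 k) v w (d k)) by rewrite hx xk uk.
exists w; split=> // j sk1.
have := hq k j sk1; rewrite -/sigma sk.
case: eqP => [[ij]|_].
  subst j; rewrite qk /= yk /= us => qk1; exists s'; split=> //.
  (* No switch: the same single-controller trajectory is one sample longer. *)
  by exists t0, m.+1, xs, qs; rewrite addnS -kE.
move=> [s1 qk1]; exists s1; split=> //.
(* Switch: a new trajectory of length zero starts from the state just reached. *)
by exists k.+1, 0%N, (plant_next P (k1 k) v w (d k)), s1; rewrite addn0.
Qed.

Variables (Ki : set R) (i : 'I_N).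
Hypothesis hk1 : parameter_in Ki k1.
Hypothesis hX0 : X i (recorded u) (recorded y) 0%N x0.
Hypothesis hXi : nonconservative P Ki (X i).

(** The two claims need each other: membership up to time [k] keeps the selected index defined, and
    a connected controller gives the finite input from which the next membership follows. *)
Let selected_connected k :
  (forall l, (l <= k)%N ->
    exists2 v, x l = Some v & X i (recorded u) (recorded y) l v) /\
  exists j v (s : cstate (C j)), connected k v s.
Proof.
have [hx0 _ hy _ [hq0 _]] := hrun.
have sel l : (forall l', (l' <= l)%N ->
    exists2 v, x l' = Some v & X i (recorded u) (recorded y) l' v) ->
    exists j, sigma l = Some j.
  move=> h; have [|j [sj _ _]] :=
    @selected_le _ _ (fun j => X j (recorded u) (recorded y)) i l.
    by move=> l' /h[v _ ?]; exists v.
  by exists j.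
elim: k => [|k [IHX [j [v [s hc]]]]].
  have hX l : (l <= 0)%N ->
      exists2 v, x l = Some v & X i (recorded u) (recorded y) l v.
    by rewrite leqn0 => /eqP ->; exists x0.
  split=> //; have [j sj] := sel _ hX.
  have [s qs] := hq0 _ sj; exists j, x0, s; split=> //.
  by exists 0%N, 0%N, x0, s.
have [w [uk xk1 hc']] := connected_next hc.
have [xk _ _ _] := hc.
have hX l : (l <= k.+1)%N ->
    exists2 v, x l = Some v & X i (recorded u) (recorded y) l v.
  rewrite leq_eqVlt ltnS => /predU1P[->|]; last exact: IHX.
  exists (plant_next P (k1 k) v w (d k)) => //.
  (* The observer sees only the record; at a finite sample it is the true input, not the default
     0. *)
  have wE : w = recorded u k by rewrite /recorded uk.
  rewrite wE; apply: (nonconservative_next hXi (hk1 k) (hd k) (hn k.+1)).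
    by have [v'] := IHX _ (leqnn k); rewrite xk => -[<-].
  by rewrite /recorded hy xk1 uk.
split=> //; have [j' sj'] := sel _ hX.
by have [s' ?] := hc' _ sj'; exists j', (plant_next P (k1 k) v w (d k)), s'.
Qed.

Lemma switch_index_nonempty k : exists j,
  switch_index X u y k = Some j /\ X j (recorded u) (recorded y) k !=set0.
Proof.
have [|j [sj _ Xj]] :=
  @selected_le _ _ (fun j => X j (recorded u) (recorded y)) i k.
  by move=> l /(selected_connected k).1[v _ ?]; exists v.
by exists j.
Qed.

(** Hypothesis [h5] concerns the response of the plant alone to a given input sequence; this
    identifies the closed-loop output with such a response. All inputs being finite, the true state
    obeys the recursion of [plant_state]. *)
Lemma recorded_plant_output :
  recorded y = plant_output P k1 d n x0 (recorded u).
Proof.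
have [hx0 _ hy _ _] := hrun.
have xE k : x k = Some (plant_state P k1 d x0 (recorded u) k).
  elim: k => [//|k IHk].
  have [_ [j [v [s hc]]]] := selected_connected k.
  have [w [uk -> _]] := connected_next hc.
  have [xk _ _ _] := hc; move: xk; rewrite IHk => -[vE].
  have wE : recorded u k = w by rewrite /recorded uk.
  by rewrite /= wE vE.
by apply/funext => k; rewrite [LHS]/recorded hy xE.
Qed.

End Plant.

Theorem theorem2 (R : realType) (nx nd nu ny N r : nat)
  (P : plant R nx nd nu ny)
  (M0 : 'M[R]_(r, nx)) (m0 : 'cV[R]_r)
  (K : set R) (Kc : 'I_N -> set R)
  (C : 'I_N -> controller R nu ny)
  (X : 'I_N -> observer R nx nu ny)
  (gamma : R)
  (Ustar : 'I_N -> (nat -> R) -> (nat -> 'cV[R]_nd) -> (nat -> 'cV[R]_ny) ->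
           'cV[R]_nx -> set (nat -> 'cV[R]_nu))
  (k1 : nat -> R) (d : nat -> 'cV[R]_nd) (n : nat -> 'cV[R]_ny)
  (x0 : 'cV[R]_nx)
  (x : nat -> option 'cV[R]_nx) (u : nat -> option 'cV[R]_nu)
  (y : nat -> option 'cV[R]_ny)
  (q : nat -> forall i : 'I_N, option (cstate (C i)))
  (hgamma : 0 < gamma)
  (hdelta : forall kappa, K kappa -> `|pldelta P kappa| <= 1)
  (hpart : partition setT Kc K)
  (hX0 : forall i v w, X i v w 0%N = polytope M0 m0)
  (hk1 : exists i, parameter_in (Kc i) k1)
  (hd : unit_bounded d) (hn : unit_bounded n) (hx0 : polytope M0 m0 x0)
  (hrun : switched_loop P X k1 d n x0 x u y q)
  (h1 : forall i, nonconservative P (Kc i) (X i))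
  (h2 : forall k v, x k = Some v -> exists i, X i (recorded u) (recorded y) k v)
  (h3 : forall i, no_finite_escape P (C i) k1)
  (h4 : forall i k1', parameter_in (Kc i) k1' ->
     stabilizes P (C i) k1' /\
     (l2_induced_norm P (C i) k1' 0 < gamma%:E)%E)
  (h5 : forall i k1', parameter_in (Kc i) k1' ->
     forall d' n' x0', unit_bounded d' -> unit_bounded n' ->
       polytope M0 m0 x0' ->
       exists t2 : nat, forall t j ustar, (t2 <= t)%N -> j != i ->
         Ustar i k1' d' n' x0' ustar ->
         X j ustar (plant_output P k1' d' n' x0' ustar) t = set0)
  (hu : forall i, parameter_in (Kc i) k1 -> Ustar i k1 d n x0 (recorded u)) :
  exists (t1 : nat) (i : 'I_N),
    (forall k, (t1 <= k)%N -> switch_index X u y k = Some i) /\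
    (l2_induced_norm P (C i) k1 t1 < gamma%:E)%E.
Proof.
have [i hi] := hk1.
have hXi0 : X i (recorded u) (recorded y) 0%N x0 by rewrite hX0.
have [t2 ht2] := h5 i k1 hi d n x0 hd hn hx0.
have yE := recorded_plant_output hd hn hrun h3 hi hXi0 (h1 i).
exists t2, i; split; last first.
  (* The shifted parameter stays in the same cell, so the bound at time 0 applies to it. *)
  by rewrite l2_induced_norm_shift; apply: (h4 i _ _).2 => k; apply: hi.
move=> k t2k.
have [j [-> [v]]] :=
  switch_index_nonempty hd hn hrun h3 hi hXi0 (h1 i) k.
(* A selected [j] other than [i] would have the point [v] in a set that is empty from [t2] on. *)
have [-> //|ji] := eqVneq j i.
by rewrite yE (ht2 k j _ t2k ji (hu i hi)).
Qed.
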